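(* Let $\gamma$ be a smooth regular curve in $\mathbb{S}^2_+\times\{0\}\subset\mathbb{S}^3$ and let $S_\gamma\subset\mathbb{S}^3$ be the surface of revolution obtained by rotating $\gamma$ about the geodesic $P$. Then $S_\gamma$ is minimal in $\mathbb{S}^3$ if and only if $\gamma$ is an extrinsic spherical catenary with $\lambda=0$.
   Context: $\mathbb{S}^2=\{(x,y,z)\in\mathbb{R}^3: x^2+y^2+z^2=1\}$, $\mathbb{S}^2_+=\{(x,y,z)\in\mathbb{S}^2: z>0\}$, $P=\{(x,y,z)\in\mathbb{S}^2:z=0\}$. $\mathbb{S}^3$ is the unit sphere of $\mathbb{R}^4$, and $\mathbb{S}^2$ is identified with $\mathbb{S}^2\times\{0\}\subset\mathbb{S}^3$ via $(x_1,x_2,x_3)\mapsto(x_1,x_2,x_3,0)$. The surface $S_\gamma$ is parametrized by $\Phi(t,s)=\mathcal{R}_s\gamma(t)$, $s\in\mathbb{R}$, where $\mathcal{R}_s$ is the rotation of $\mathbb{R}^4$ fixing $x_1,x_2$ and acting on the $(x_3,x_4)$-plane as rotation of angle $s$; explicitly, if $\gamma=(x(t),y(t),z(t),0)$ then $\Phi(t,s)=(x(t),y(t),z(t)\cos s,z(t)\sin s)$. Minimal means that the mean curvature of $S_\gamma$ as a surface in $\mathbb{S}^3$ vanishes identically. For a curve $\gamma=(x,y,z):[a,b]\to\mathbb{S}^2_+$, the extrinsic potential energy with parameter $\lambda\in\mathbb{R}$ is $\mathcal{E}^{ex}_S[\gamma]=\int_a^b(z(t)+\lambda)|\gamma'(t)|\,dt$;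 writing $\gamma=\Psi(u,v)$ with $\Psi(u,v)=(\cos u\cos v,\cos u\sin v,\sin u)$ it equals $\int_a^b(\sin u+\lambda)\sqrt{u'^2+v'^2\cos^2u}\,dt$. An extrinsic spherical catenary is a critical point of $\mathcal{E}^{ex}_S$, i.e. a curve at which the first variation vanishes for all smooth variations in $\mathbb{S}^2_+$ with fixed endpoints (equivalently, it satisfies the Euler–Lagrange equations of the energy). *)

(* Defs.v *)
From Stdlib Require Export Reals.
From Coquelicot Require Export Coquelicot.
Open Scope R_scope.

Definition R3 : Type := (R * R * R)%type.
Definition R4 : Type := (R * R * R * R)%type.

Definition c3_1 (p : R3) : R := fst (fst p).
Definition c3_2 (p : R3) : R := snd (fst p).
Definition c3_3 (p : R3) : R := snd p.

Definition c4_1 (p : R4) : R := fst (fst (fst p)).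
Definition c4_2 (p : R4) : R := snd (fst (fst p)).
Definition c4_3 (p : R4) : R := snd (fst p).
Definition c4_4 (p : R4) : R := snd p.

Definition dot3 (p q : R3) : R :=
  c3_1 p * c3_1 q + c3_2 p * c3_2 q + c3_3 p * c3_3 q.

Definition dot4 (p q : R4) : R :=
  c4_1 p * c4_1 q + c4_2 p * c4_2 q + c4_3 p * c4_3 q + c4_4 p * c4_4 q.

Definition norm3 (p : R3) : R := sqrt (dot3 p p).

Definition deriv3 (gamma : R -> R3) (t : R) : R3 :=
  (Derive (fun u => c3_1 (gamma u)) t,
   Derive (fun u => c3_2 (gamma u)) t,
   Derive (fun u => c3_3 (gamma u)) t).

Definition deriv4 (c : R -> R4) (t : R) : R4 :=
  (Derive (fun u => c4_1 (c u)) t,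
   Derive (fun u => c4_2 (c u)) t,
   Derive (fun u => c4_3 (c u)) t,
   Derive (fun u => c4_4 (c u)) t).

(* C^infinity in a neighbourhood of a point.  Maps on [a, b] (and variations of
   them) are represented by total functions that are smooth in a neighbourhood
   of each point of their domain, so that the two-sided [Derive] is meaningful
   at the end points; geometric constraints are only imposed on the domain. *)
Definition smooth_near (f : R -> R) (t : R) : Prop :=
  locally t (fun u => forall n : nat, ex_derive_n f n u).

Definition smooth_near_2d (f : R -> R -> R) (s t : R) : Prop :=
  locally_2d (fun u v => forall n : nat, ex_diff_n f n u v) s t.

Definition smooth_near3 (gamma : R -> R3) (t : R) : Prop :=
  smooth_near (fun u => c3_1 (gamma u)) t /\
  smooth_near (fun u => c3_2 (gamma u)) t /\
  smooth_near (fun u => c3_3 (gamma u)) t.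

Definition smooth_near3_2d (Gamma : R -> R -> R3) (s t : R) : Prop :=
  smooth_near_2d (fun u v => c3_1 (Gamma u v)) s t /\
  smooth_near_2d (fun u v => c3_2 (Gamma u v)) s t /\
  smooth_near_2d (fun u v => c3_3 (Gamma u v)) s t.

Definition open_hemisphere (p : R3) : Prop := dot3 p p = 1 /\ 0 < c3_3 p.

Definition smooth_regular_curve (a b : R) (gamma : R -> R3) : Prop :=
  forall t, a <= t <= b ->
    smooth_near3 gamma t /\ deriv3 gamma t <> (0, 0, 0).

Definition incl (p : R3) : R4 := (c3_1 p, c3_2 p, c3_3 p, 0).

Definition rot (s : R) (p : R4) : R4 :=
  (c4_1 p, c4_2 p,
   cos s * c4_3 p - sin s * c4_4 p,
   sin s * c4_3 p + cos s * c4_4 p).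

Definition surface_of_revolution (gamma : R -> R3) (t s : R) : R4 :=
  rot s (incl (gamma t)).

Definition partial_t (Phi : R -> R -> R4) (t s : R) : R4 :=
  deriv4 (fun u => Phi u s) t.

Definition partial_s (Phi : R -> R -> R4) (t s : R) : R4 :=
  deriv4 (fun u => Phi t u) s.

(* Unit vector tangent to the 3-sphere at Phi(t,s) and normal to the surface;
   it is unique up to sign when Phi is an immersion into the 3-sphere. *)
Definition is_unit_normal (Phi : R -> R -> R4) (t s : R) (N : R4) : Prop :=
  dot4 N N = 1 /\
  dot4 (Phi t s) N = 0 /\
  dot4 (partial_t Phi t s) N = 0 /\
  dot4 (partial_s Phi t s) N = 0.

(* The mean curvature in the 3-sphere with respect to N.  The second fundamental
   form of the surface in the sphere is computed with the derivatives of R^4,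
   because these differ from the covariant derivatives of the sphere by multiples
   of the position vector Phi, which is orthogonal to N. *)
Definition mean_curvature (Phi : R -> R -> R4) (N : R4) (t s : R) : R :=
  let Phit := partial_t Phi t s in
  let Phis := partial_s Phi t s in
  let E := dot4 Phit Phit in
  let F := dot4 Phit Phis in
  let G := dot4 Phis Phis in
  let e := dot4 (partial_t (partial_t Phi) t s) N in
  let f := dot4 (partial_t (partial_s Phi) t s) N in
  let g := dot4 (partial_s (partial_s Phi) t s) N in
  (e * G - 2 * f * F + g * E) / (2 * (E * G - F ^ 2)).

(* For an immersion of [a, b] x R into the 3-sphere. *)
Definition minimal_in_S3 (a b : R) (Phi : R -> R -> R4) : Prop :=
  forall t s : R, a <= t <= b ->
  forall N : R4, is_unit_normal Phi t s N -> mean_curvature Phi N t s = 0.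

Definition extrinsic_energy (lambda a b : R) (gamma : R -> R3) : R :=
  RInt (fun t => (c3_3 (gamma t) + lambda) * norm3 (deriv3 gamma t)) a b.

Definition smooth_variation (a b : R) (gamma : R -> R3) (delta : R)
    (Gamma : R -> R -> R3) : Prop :=
  (forall eps t, Rabs eps < delta -> a <= t <= b ->
     smooth_near3_2d Gamma eps t /\ open_hemisphere (Gamma eps t)) /\
  (forall t, a <= t <= b -> Gamma 0 t = gamma t) /\
  (forall eps, Rabs eps < delta ->
     Gamma eps a = gamma a /\ Gamma eps b = gamma b).

Definition extrinsic_spherical_catenary (lambda a b : R) (gamma : R -> R3)
    : Prop :=
  forall (delta : R) (Gamma : R -> R -> R3),
    0 < delta -> smooth_variation a b gamma delta Gamma ->
    is_derive (fun eps => extrinsic_energy lambda a b (Gamma eps)) 0 0.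

(* Main.v *)
Require Import Defs.
From Stdlib Require Import Lra Lia.

(* With n = c x c' and K = z <c'', n> - n_3 |c'|^2 ([euler_lagrange] below), the
   mean curvature of the surface of revolution of c is K up to a nonzero factor.  On the other hand,
   integrating by parts and using that a variation field xi is tangent to the
   sphere, the first variation of the energy with lambda = 0 is the integral of
   - <xi, n> K / |c'|^3.  So K = 0 makes c critical.  Conversely the normal
   variation with coefficient (t - a) (b - t) K vanishes at the end points, and
   turns the first variation into minus the integral of a nonnegative multiple of
   K^2, hence K = 0 without any bump function. *)

(** * Calculus of functions smooth near a point of the plane *)

(** Curves and variations are smooth beyond [a, b], but they satisfy the constraints, and agree with
    one another, only on [a, b], whereas [Derive] is two-sided. A relation differentiated in t
    therefore holds at first in the open interval, where it is valid near each time; the end points,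
    where they matter, are reached by continuity. A second obstacle is uniformity: the speed is a
    square root, smooth only where its argument is positive, and a variation must keep z > 0 with
    one delta for all times. Both follow from compactness of [a, b]. Only <xi, n> survives in the
    first variation because the component of xi along the curve merely reparametrizes it. Since K is
    polynomial in c, c', c'', it is smooth and can itself be the coefficient of a variation. *)

Definition d1 (f : R -> R -> R) (x y : R) : R := Derive (fun u => f u y) x.
Definition d2 (f : R -> R -> R) (x y : R) : R := Derive (fun v => f x v) y.

Definition open_2d (O : R -> R -> Prop) : Prop :=
  forall x y, O x y -> locally_2d O x y.

(** The recursion in [ex_diff_n] passes from f to the functions giving its partial derivatives, and
    explicit formulas for these must hold near the point. Inductions on n therefore run over a whole
    open set instead of a single point. *)
Definition diff_on (O : R -> R -> Prop) (n : nat) (f : R -> R -> R) : Prop :=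
  forall x y, O x y -> ex_diff_n f n x y.

Lemma diff_on_continuity (O : R -> R -> Prop) (n : nat) (f : R -> R -> R) :
  diff_on O n f -> forall x y, O x y -> continuity_2d_pt f x y.
Proof.
  intros Hf x y HO. specialize (Hf x y HO). destruct n; apply Hf.
Qed.

Lemma diff_on_le (O : R -> R -> Prop) (m n : nat) (f : R -> R -> R) :
  (m <= n)%nat -> diff_on O n f -> diff_on O m f.
Proof.
  intros Hmn Hf x y HO. apply (ex_diff_n_m _ _ Hmn), Hf, HO.
Qed.

Lemma diff_on_S_inv (O : R -> R -> Prop) (n : nat) (f : R -> R -> R) :
  diff_on O (S n) f ->
  diff_on O n f /\ diff_on O n (d1 f) /\ diff_on O n (d2 f) /\
  (forall x y, O x y -> is_derive (fun u => f u y) x (d1 f x y)) /\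
  (forall x y, O x y -> is_derive (fun v => f x v) y (d2 f x y)).
Proof.
  intros Hf. split; [| split; [| split; [| split]]].
  - apply (diff_on_le _ _ (S n)); [lia | exact Hf].
  - intros x y HO. apply Hf, HO.
  - intros x y HO. apply Hf, HO.
  - intros x y HO. apply Derive_correct, (Hf x y HO).
  - intros x y HO. apply Derive_correct, (Hf x y HO).
Qed.

(** Openness turns the pointwise formulas f1, f2 into equalities near each point, which is what
    replacing the partial derivatives inside [ex_diff_n] requires. *)
Lemma diff_on_S (O : R -> R -> Prop) (n : nat) (f f1 f2 : R -> R -> R) :
  open_2d O ->
  (forall x y, O x y -> continuity_2d_pt f x y) ->
  (forall x y, O x y -> is_derive (fun u => f u y) x (f1 x y)) ->
  (forall x y, O x y -> is_derive (fun v => f x v) y (f2 x y)) ->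
  diff_on O n f1 -> diff_on O n f2 -> diff_on O (S n) f.
Proof.
  intros Hop Hc H1 H2 D1 D2 x y HO.
  split; [now apply Hc |]. split; [eexists; now apply H1 |].
  split; [eexists; now apply H2 |].
  destruct (Hop x y HO) as [d Hd].
  split.
  - apply ex_diff_n_ext_loc with (2 := D1 x y HO).
    exists d; intros u v Hu Hv. symmetry.
    apply is_derive_unique, H1, Hd; assumption.
  - apply ex_diff_n_ext_loc with (2 := D2 x y HO).
    exists d; intros u v Hu Hv. symmetry.
    apply is_derive_unique, H2, Hd; assumption.
Qed.

Lemma is_derive_Rmult (f g : R -> R) (x df dg : R) :
  is_derive f x df -> is_derive g x dg ->
  is_derive (fun u => f u * g u) x (df * g x + f x * dg).
Proof. intros Hf Hg. apply (is_derive_mult f g); auto. intros; apply Rmult_comm. Qed.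

Lemma diff_on_const (O : R -> R -> Prop) (n : nat) (c : R) :
  open_2d O -> diff_on O n (fun _ _ => c).
Proof.
  intros Hop. revert c. induction n as [|n IH]; intros c.
  - intros x y _. split; [apply continuity_2d_pt_const | exact I].
  - apply diff_on_S with (f1 := fun _ _ => 0) (f2 := fun _ _ => 0); auto.
    + intros; apply continuity_2d_pt_const.
    + intros; apply @is_derive_const.
    + intros; apply @is_derive_const.
Qed.

Lemma diff_on_plus (O : R -> R -> Prop) (n : nat) (f g : R -> R -> R) :
  open_2d O -> diff_on O n f -> diff_on O n g ->
  diff_on O n (fun u v => f u v + g u v).
Proof.
  intros Hop. revert f g. induction n as [|n IH]; intros f g Hf Hg.
  - intros x y HO.
    split; [apply continuity_2d_pt_plus; [apply Hf | apply Hg]; assumption | exact I].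
  - pose proof (diff_on_continuity _ _ _ Hf) as Cf.
    pose proof (diff_on_continuity _ _ _ Hg) as Cg.
    apply diff_on_S_inv in Hf as (Lf & F1 & F2 & Df1 & Df2).
    apply diff_on_S_inv in Hg as (Lg & G1 & G2 & Dg1 & Dg2).
    apply diff_on_S with
      (f1 := fun u v => d1 f u v + d1 g u v) (f2 := fun u v => d2 f u v + d2 g u v); auto.
    + intros; apply continuity_2d_pt_plus; auto.
    + intros; apply @is_derive_plus; auto.
    + intros; apply @is_derive_plus; auto.
Qed.

Lemma diff_on_mult (O : R -> R -> Prop) (n : nat) (f g : R -> R -> R) :
  open_2d O -> diff_on O n f -> diff_on O n g ->
  diff_on O n (fun u v => f u v * g u v).
Proof.
  intros Hop. revert f g. induction n as [|n IH]; intros f g Hf Hg.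
  - intros x y HO.
    split; [apply continuity_2d_pt_mult; [apply Hf | apply Hg]; assumption | exact I].
  - pose proof (diff_on_continuity _ _ _ Hf) as Cf.
    pose proof (diff_on_continuity _ _ _ Hg) as Cg.
    apply diff_on_S_inv in Hf as (Lf & F1 & F2 & Df1 & Df2).
    apply diff_on_S_inv in Hg as (Lg & G1 & G2 & Dg1 & Dg2).
    apply diff_on_S with
      (f1 := fun u v => d1 f u v * g u v + f u v * d1 g u v)
      (f2 := fun u v => d2 f u v * g u v + f u v * d2 g u v);
      auto using diff_on_plus.
    + intros; apply continuity_2d_pt_mult; auto.
    + intros x y HO. apply (is_derive_Rmult (fun u => f u y) (fun u => g u y)); auto.
    + intros x y HO. apply (is_derive_Rmult (fun v => f x v) (fun v => g x v)); auto.
Qed.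

Lemma diff_on_inv (O : R -> R -> Prop) (n : nat) (f : R -> R -> R) :
  open_2d O -> (forall x y, O x y -> f x y <> 0) -> diff_on O n f ->
  diff_on O n (fun u v => / f u v).
Proof.
  intros Hop H0. induction n as [|n IH]; intros Hf.
  - intros x y HO.
    split; [apply continuity_2d_pt_inv; [apply Hf |]; auto | exact I].
  - pose proof (diff_on_continuity _ _ _ Hf) as Cf.
    apply diff_on_S_inv in Hf as (Lf & F1 & F2 & Df1 & Df2).
    (* The derivative of the inverse is written as a product containing / f twice, so that the
       induction hypothesis applies to these factors. *)
    apply diff_on_S with
      (f1 := fun u v => (-1 * d1 f u v) * (/ f u v * / f u v))
      (f2 := fun u v => (-1 * d2 f u v) * (/ f u v * / f u v));
      auto using diff_on_mult, diff_on_const.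
    + intros; apply continuity_2d_pt_inv; auto.
    + intros x y HO.
      replace (-1 * d1 f x y * (/ f x y * / f x y)) with (- d1 f x y / f x y ^ 2)
        by (field; auto).
      apply (is_derive_inv (fun u => f u y)); auto.
    + intros x y HO.
      replace (-1 * d2 f x y * (/ f x y * / f x y)) with (- d2 f x y / f x y ^ 2)
        by (field; auto).
      apply (is_derive_inv (fun v => f x v)); auto.
Qed.

Lemma continuity_2d_pt_sqrt (f : R -> R -> R) (x y : R) :
  0 < f x y -> continuity_2d_pt f x y -> continuity_2d_pt (fun u v => sqrt (f u v)) x y.
Proof.
  intros H0 Hc. apply (continuity_1d_2d_pt_comp sqrt); [| exact Hc].
  apply continuity_pt_sqrt; lra.
Qed.

Lemma diff_on_sqrt (O : R -> R -> Prop) (n : nat) (f : R -> R -> R) :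
  open_2d O -> (forall x y, O x y -> 0 < f x y) -> diff_on O n f ->
  diff_on O n (fun u v => sqrt (f u v)).
Proof.
  intros Hop H0. induction n as [|n IH]; intros Hf.
  - intros x y HO.
    split; [apply continuity_2d_pt_sqrt; [| apply Hf]; auto | exact I].
  - pose proof (diff_on_continuity _ _ _ Hf) as Cf.
    apply diff_on_S_inv in Hf as (Lf & F1 & F2 & Df1 & Df2).
    assert (Hs : forall x y, O x y -> 2 * sqrt (f x y) <> 0).
    { intros x y HO. pose proof (sqrt_lt_R0 _ (H0 x y HO)). lra. }
    assert (Hinv : diff_on O n (fun u v => / (2 * sqrt (f u v)))).
    { apply diff_on_inv; auto using diff_on_mult, diff_on_const. }
    apply diff_on_S with
      (f1 := fun u v => d1 f u v * / (2 * sqrt (f u v)))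
      (f2 := fun u v => d2 f u v * / (2 * sqrt (f u v)));
      auto using diff_on_mult, continuity_2d_pt_sqrt.
    + intros x y HO. apply (is_derive_sqrt (fun u => f u y)); auto.
    + intros x y HO. apply (is_derive_sqrt (fun v => f x v)); auto.
Qed.

(** * Smoothness near a point, deduced from differentiability on open sets *)

Lemma locally_2d_open (P : R -> R -> Prop) : open_2d (locally_2d P).
Proof.
  intros x y H. apply locally_2d_impl_strong with (2 := H).
  apply locally_2d_forall; auto.
Qed.

(** The open set O is the set of points having a neighbourhood on which P holds and f is infinitely
    differentiable. The predicate P carries side conditions such as f <> 0 or 0 < f. *)
Lemma smooth_near_2d_mono (P : R -> R -> Prop) (f g : R -> R -> R) (x y : R) :
  (forall O n, open_2d O -> (forall u v, O u v -> P u v) -> diff_on O n f -> diff_on O n g) ->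
  locally_2d P x y -> smooth_near_2d f x y -> smooth_near_2d g x y.
Proof.
  intros Hop HP Hf. unfold smooth_near_2d.
  pose proof (locally_2d_and _ _ _ _ HP Hf) as H.
  apply locally_2d_impl_strong with (2 := H), locally_2d_forall.
  intros u v Huv n.
  apply Hop with (1 := locally_2d_open
    (fun u v => P u v /\ forall n : nat, ex_diff_n f n u v)) (n := n); [| | exact Huv].
  - intros u' v' H'. apply (locally_2d_singleton _ _ _ H').
  - intros u' v' H'. apply (locally_2d_singleton _ _ _ H').
Qed.

Lemma smooth_near_2d_binop (op : R -> R -> R) (f g : R -> R -> R) (x y : R) :
  (forall O n, open_2d O -> diff_on O n f -> diff_on O n g ->
     diff_on O n (fun u v => op (f u v) (g u v))) ->
  smooth_near_2d f x y -> smooth_near_2d g x y ->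
  smooth_near_2d (fun u v => op (f u v) (g u v)) x y.
Proof.
  intros Hop Hf Hg. unfold smooth_near_2d.
  (* Here P is the infinite differentiability of f, which reduces two arguments to one. *)
  apply smooth_near_2d_mono with (3 := Hg) (2 := Hf).
  intros O n HO Hfn Hgn. apply Hop; auto. intros u v Huv. now apply Hfn.
Qed.

Lemma smooth_near_2d_plus (f g : R -> R -> R) (x y : R) :
  smooth_near_2d f x y -> smooth_near_2d g x y ->
  smooth_near_2d (fun u v => f u v + g u v) x y.
Proof. apply smooth_near_2d_binop; auto using diff_on_plus. Qed.

Lemma smooth_near_2d_mult (f g : R -> R -> R) (x y : R) :
  smooth_near_2d f x y -> smooth_near_2d g x y ->
  smooth_near_2d (fun u v => f u v * g u v) x y.
Proof. apply smooth_near_2d_binop; auto using diff_on_mult. Qed.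

Lemma smooth_near_2d_const (c x y : R) : smooth_near_2d (fun _ _ => c) x y.
Proof.
  apply locally_2d_forall. intros u v n.
  apply (diff_on_const (fun _ _ => True)); [| exact I].
  intros u' v' _. now apply locally_2d_forall.
Qed.

Lemma smooth_near_2d_ext (f g : R -> R -> R) (x y : R) :
  (forall u v, f u v = g u v) -> smooth_near_2d f x y -> smooth_near_2d g x y.
Proof.
  intros Hfg. apply smooth_near_2d_mono with (P := fun _ _ => True).
  - intros O n _ _ Hf u v HO. apply ex_diff_n_ext_loc with (2 := Hf u v HO).
    now apply locally_2d_forall.
  - now apply locally_2d_forall.
Qed.

Lemma smooth_near_2d_opp (f : R -> R -> R) (x y : R) :
  smooth_near_2d f x y -> smooth_near_2d (fun u v => - f u v) x y.
Proof.
  intros Hf. apply (smooth_near_2d_ext (fun u v => -1 * f u v)); [intros; ring |].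
  apply smooth_near_2d_mult; [apply smooth_near_2d_const | exact Hf].
Qed.

Lemma smooth_near_2d_minus (f g : R -> R -> R) (x y : R) :
  smooth_near_2d f x y -> smooth_near_2d g x y ->
  smooth_near_2d (fun u v => f u v - g u v) x y.
Proof.
  intros Hf Hg. apply smooth_near_2d_plus; [exact Hf | now apply smooth_near_2d_opp].
Qed.

Lemma smooth_near_2d_pow (f : R -> R -> R) (n : nat) (x y : R) :
  smooth_near_2d f x y -> smooth_near_2d (fun u v => f u v ^ n) x y.
Proof.
  intros Hf. induction n as [|n IH]; [apply (smooth_near_2d_const 1) |].
  now apply (smooth_near_2d_mult f (fun u v => f u v ^ n)).
Qed.

Lemma smooth_near_2d_continuity (f : R -> R -> R) (x y : R) :
  smooth_near_2d f x y -> continuity_2d_pt f x y.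
Proof. intros Hf. exact (proj1 (locally_2d_singleton _ _ _ Hf 0%nat)). Qed.

Lemma continuity_2d_pt_pos (f : R -> R -> R) (x y : R) :
  continuity_2d_pt f x y -> 0 < f x y -> locally_2d (fun u v => 0 < f u v) x y.
Proof.
  intros Hc H0. destruct (Hc (mkposreal _ H0)) as [d Hd]. exists d. intros u v Hu Hv.
  specialize (Hd u v Hu Hv). simpl in Hd. apply Rabs_def2 in Hd. lra.
Qed.

Lemma smooth_near_2d_inv (f : R -> R -> R) (x y : R) :
  f x y <> 0 -> smooth_near_2d f x y -> smooth_near_2d (fun u v => / f u v) x y.
Proof.
  intros H0 Hf. apply smooth_near_2d_mono with (3 := Hf) (P := fun u v => f u v <> 0).
  - intros; now apply diff_on_inv.
  - apply continuity_2d_pt_neq_0; [now apply smooth_near_2d_continuity | exact H0].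
Qed.

Lemma smooth_near_2d_div (f g : R -> R -> R) (x y : R) :
  g x y <> 0 -> smooth_near_2d f x y -> smooth_near_2d g x y ->
  smooth_near_2d (fun u v => f u v / g u v) x y.
Proof.
  intros H0 Hf Hg. apply smooth_near_2d_mult; [exact Hf | now apply smooth_near_2d_inv].
Qed.

Lemma smooth_near_2d_sqrt (f : R -> R -> R) (x y : R) :
  0 < f x y -> smooth_near_2d f x y -> smooth_near_2d (fun u v => sqrt (f u v)) x y.
Proof.
  intros H0 Hf. apply smooth_near_2d_mono with (3 := Hf) (P := fun u v => 0 < f u v).
  - intros; now apply diff_on_sqrt.
  - apply continuity_2d_pt_pos; [now apply smooth_near_2d_continuity | exact H0].
Qed.

Lemma smooth_near_2d_d1 (f : R -> R -> R) (x y : R) :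
  smooth_near_2d f x y -> smooth_near_2d (d1 f) x y.
Proof.
  intros Hf. apply locally_2d_impl with (2 := Hf), locally_2d_forall.
  intros u v H n. apply (H (S n)).
Qed.

Lemma smooth_near_2d_d2 (f : R -> R -> R) (x y : R) :
  smooth_near_2d f x y -> smooth_near_2d (d2 f) x y.
Proof.
  intros Hf. apply locally_2d_impl with (2 := Hf), locally_2d_forall.
  intros u v H n. apply (H (S n)).
Qed.

Lemma smooth_near_2d_is_derive_1 (f : R -> R -> R) (x y : R) :
  smooth_near_2d f x y -> is_derive (fun u => f u y) x (d1 f x y).
Proof.
  intros Hf. apply Derive_correct, (locally_2d_singleton _ _ _ Hf 1%nat).
Qed.

Lemma smooth_near_2d_is_derive_2 (f : R -> R -> R) (x y : R) :
  smooth_near_2d f x y -> is_derive (fun v => f x v) y (d2 f x y).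
Proof.
  intros Hf. apply Derive_correct, (locally_2d_singleton _ _ _ Hf 1%nat).
Qed.

Lemma smooth_near_2d_continuous_2 (f : R -> R -> R) (x y : R) :
  smooth_near_2d f x y -> continuous (fun v => f x v) y.
Proof.
  intros Hf. apply @ex_derive_continuous. eexists.
  now apply smooth_near_2d_is_derive_2.
Qed.

Lemma smooth_near_2d_Schwarz (f : R -> R -> R) (x y : R) :
  smooth_near_2d f x y -> d1 (d2 f) x y = d2 (d1 f) x y.
Proof.
  intros Hf. apply Schwarz.
  - apply locally_2d_impl with (2 := Hf), locally_2d_forall. intros u v H.
    destruct (H 2%nat) as (_ & E1 & E2 & (_ & _ & E12 & _) & (_ & E21 & _ & _)). auto.
  - apply (smooth_near_2d_continuity (d1 (d2 f))).
    now apply smooth_near_2d_d1, smooth_near_2d_d2.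
  - apply (smooth_near_2d_continuity (d2 (d1 f))).
    now apply smooth_near_2d_d2, smooth_near_2d_d1.
Qed.

(** Brings single curves under the calculus of two variables: a function of t is viewed as a family
    that is constant in the first variable. *)
Lemma smooth_near_2d_lift (f : R -> R) (x y : R) :
  smooth_near f y -> smooth_near_2d (fun _ v => f v) x y.
Proof.
  intros [d Hd]. exists d. intros u v _ Hv n.
  revert u v Hv. change (diff_on (fun _ v => Rabs (v - y) < d) n (fun _ v => f v)).
  assert (Hop : open_2d (fun _ v => Rabs (v - y) < d)).
  { intros u v Hv. assert (Hp : 0 < d - Rabs (v - y)) by lra.
    exists (mkposreal _ Hp); simpl. intros u' v' _ Hv'.
    replace (v' - y) with ((v' - v) + (v - y)) by ring.
    apply Rle_lt_trans with (1 := Rabs_triang _ _). lra. }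
  assert (Hd' : forall v, Rabs (v - y) < d -> forall k, ex_derive_n f k v)
    by (intros v Hv; exact (Hd v Hv)).
  clear Hd. revert f Hd'. induction n as [|n IH]; intros f Hf.
  - intros u v Hv. split; [| exact I].
    apply (continuity_1d_2d_pt_comp f); [| apply continuity_2d_pt_id2].
    apply continuity_pt_filterlim, (@ex_derive_continuous R_AbsRing), (Hf v Hv 1%nat).
  - apply diff_on_S with (f1 := fun _ _ => 0) (f2 := fun _ v => Derive f v);
      auto using diff_on_const.
    + intros u v Hv.
      apply (continuity_1d_2d_pt_comp f); [| apply continuity_2d_pt_id2].
      apply continuity_pt_filterlim, (@ex_derive_continuous R_AbsRing), (Hf v Hv 1%nat).
    + intros; apply @is_derive_const.
    + intros u v Hv. apply Derive_correct, (Hf v Hv 1%nat).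
    + apply IH. intros v Hv [|k]; [exact I |].
      apply ex_derive_ext with (Derive_n f (S k)); [| exact (Hf v Hv (S (S k)))].
      intros t. rewrite (Derive_n_comp f k 1). f_equal. lia.
Qed.

Lemma smooth_near_2d_fst (x y : R) : smooth_near_2d (fun u _ => u) x y.
Proof.
  apply locally_2d_forall. intros u v n.
  assert (Hop : open_2d (fun _ _ => True))
    by (intros u' v' _; now apply locally_2d_forall).
  revert u v. enough (H : diff_on (fun _ _ => True) n (fun u _ => u)) by auto.
  destruct n as [|n].
  - intros u v _. split; [apply continuity_2d_pt_id1 | exact I].
  - apply diff_on_S with (f1 := fun _ _ => 1) (f2 := fun _ _ => 0);
      auto using diff_on_const.
    + intros; apply continuity_2d_pt_id1.
    + intros; apply @is_derive_id.
    + intros; apply @is_derive_const.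
Qed.

Lemma smooth_near_2d_snd (x y : R) : smooth_near_2d (fun _ v => v) x y.
Proof.
  apply locally_2d_forall. intros u v n.
  assert (Hop : open_2d (fun _ _ => True))
    by (intros u' v' _; now apply locally_2d_forall).
  revert u v. enough (H : diff_on (fun _ _ => True) n (fun _ v => v)) by auto.
  destruct n as [|n].
  - intros u v _. split; [apply continuity_2d_pt_id2 | exact I].
  - apply diff_on_S with (f1 := fun _ _ => 0) (f2 := fun _ _ => 1);
      auto using diff_on_const.
    + intros; apply continuity_2d_pt_id2.
    + intros; apply @is_derive_const.
    + intros; apply @is_derive_id.
Qed.

(** * Compactness, continuity and integrals on a closed interval *)

(** The minimum of f x over the segment is positive, and uniform continuity with that minimum as
    tolerance gives one delta for all times. It is applied to the squared speed and to the height of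
    a variation. *)
Lemma segment_positivity (f : R -> R -> R) (a b x : R) :
  (forall t, a <= t <= b -> continuity_2d_pt f x t) ->
  (forall t, a <= t <= b -> 0 < f x t) ->
  exists delta : posreal,
    forall u t, Rabs (u - x) < delta -> a <= t <= b -> 0 < f u t.
Proof.
  intros Hc Hp.
  destruct (Rle_dec a b) as [Hab | Hab]; [| exists (mkposreal 1 Rlt_0_1); intros; lra].
  destruct (continuity_ab_min (fun t => f x t) a b Hab) as [m [Hm Hmab]].
  { intros t Ht. apply continuity_pt_filterlim.
    intros P [e He]. destruct (Hc t Ht e) as [d Hd]. exists d. intros v Hv.
    apply He, Hd; [rewrite Rminus_eq_0, Rabs_R0; apply cond_pos | exact Hv]. }
  destruct (uniform_continuity_2d_1d' f a b x Hc (mkposreal _ (Hp m Hmab))) as [d Hd].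
  exists d. intros u t Hu Ht.
  specialize (Hd t x t u Ht). apply Rabs_def2 in Hu.
  pose proof (cond_pos d) as Hd0.
  assert (H : Rabs (f u t - f x t) < f x m).
  { apply Hd; try lra. rewrite Rminus_eq_0, Rabs_R0. exact Hd0. }
  apply Rabs_def2 in H. specialize (Hm t Ht). lra.
Qed.

Ltac smooth_2d :=
  repeat first
    [ assumption
    | apply smooth_near_2d_const
    | apply smooth_near_2d_fst
    | apply smooth_near_2d_snd
    | apply smooth_near_2d_plus
    | apply smooth_near_2d_minus
    | apply smooth_near_2d_opp
    | apply smooth_near_2d_mult
    | apply smooth_near_2d_pow
    | apply smooth_near_2d_div
    | apply smooth_near_2d_d1
    | apply smooth_near_2d_d2 ].

Lemma eq_0_on_closed_interval (h : R -> R) (a b t : R) :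
  a < b -> (forall u, a < u < b -> h u = 0) -> a <= t <= b -> continuous h t -> h t = 0.
Proof.
  intros Hab H0 Ht Hc. destruct (Req_dec (h t) 0) as [E | E]; [exact E | exfalso].
  assert (Hpos : 0 < Rabs (h t)) by now apply Rabs_pos_lt.
  destruct (proj1 (filterlim_locally (F := locally t) h (h t)) Hc (mkposreal _ Hpos)) as [d Hd].
  pose proof (cond_pos d) as Hd0.
  set (r := Rmin 1 (d / (b - a))).
  assert (Hr : 0 < r) by (apply Rmin_glb_lt; [lra | apply Rdiv_lt_0_compat; lra]).
  assert (Hr1 : r <= 1) by apply Rmin_l.
  assert (Hrd : r * (b - a) <= d).
  { apply Rle_trans with (d / (b - a) * (b - a)).
    - apply Rmult_le_compat_r; [lra | apply Rmin_r].
    - right; field; lra. }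
  (* Moving t by a fraction r towards the midpoint lands in the open interval even from an end
     point; the choice of r keeps the displacement below d. *)
  set (u := t + r * ((a + b) / 2 - t)).
  assert (Hu : a < u < b) by (unfold u; split; nra).
  assert (Hball : ball t d u).
  { change (Rabs (u - t) < d). unfold u.
    replace (t + r * ((a + b) / 2 - t) - t) with (r * ((a + b) / 2 - t)) by ring.
    rewrite Rabs_mult, (Rabs_pos_eq r) by lra.
    apply Rle_lt_trans with (r * ((b - a) / 2)); [| nra].
    apply Rmult_le_compat_l; [lra |]. apply Rabs_le. lra. }
  specialize (Hd u Hball). rewrite (H0 u Hu) in Hd.
  change (Rabs (0 - h t) < Rabs (h t)) in Hd.
  rewrite Rminus_0_l, Rabs_Ropp in Hd. lra.
Qed.

Lemma locally_open_interval (a b t : R) (P : R -> Prop) :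
  (forall u, a < u < b -> P u) -> a < t < b -> locally t P.
Proof.
  intros HP Ht. apply (locally_interval _ t a b); simpl; try tauto.
  intros u Hau Hub. now apply HP.
Qed.

(** At an end point the two-sided derivative also sees values of f outside [a, b], which are
    unconstrained. There the conclusion comes from the inside, by continuity of d2 f. *)
Lemma d2_eq_0_on_closed_interval (f : R -> R -> R) (a b x t : R) :
  a < b -> (forall u, a <= u <= b -> smooth_near_2d f x u) ->
  (forall u, a < u < b -> f x u = 0) -> a <= t <= b -> d2 f x t = 0.
Proof.
  intros Hab Hs H0 Ht.
  apply (eq_0_on_closed_interval (fun v => d2 f x v) a b); auto.
  - intros u Hu. unfold d2. rewrite <- (Derive_const 0 u).
    apply Derive_ext_loc, (locally_open_interval a b); auto.
  - now apply smooth_near_2d_continuous_2, smooth_near_2d_d2, Hs.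
Qed.

Lemma RInt_nonneg_eq_0 (g : R -> R) (a b t : R) :
  (forall u, a <= u <= b -> continuous g u) -> (forall u, a <= u <= b -> 0 <= g u) ->
  RInt g a b = 0 -> a < t < b -> g t = 0.
Proof.
  intros Hc Hp Hi Ht.
  destruct (Rle_lt_or_eq_dec 0 (g t)) as [Hgt | E]; [apply Hp; lra | exfalso | now symmetry].
  destruct (proj1 (filterlim_locally (F := locally t) g (g t)) (Hc t ltac:(lra)) (mkposreal _ Hgt))
    as [d Hd].
  pose proof (cond_pos d) as Hd0.
  (* The interval of radius d / 2 about t is cut to [a, b]; the half keeps it well inside the ball
     on which g is positive. *)
  set (c := Rmax a (t - d / 2)). set (e := Rmin b (t + d / 2)).
  assert (a <= c) by apply Rmax_l. assert (t - d / 2 <= c) by apply Rmax_r.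
  assert (e <= b) by apply Rmin_l. assert (e <= t + d / 2) by apply Rmin_r.
  assert (c < t) by (apply Rmax_lub_lt; lra).
  assert (t < e) by (apply Rmin_glb_lt; lra).
  assert (Hex : forall p q, a <= p -> p <= q -> q <= b -> ex_RInt g p q).
  { intros p q Hp1 Hp2 Hp3. apply @ex_RInt_continuous. intros u.
    rewrite Rmin_left, Rmax_right by lra. intros Hu. apply Hc. lra. }
  assert (I1 : 0 <= RInt g a c).
  { apply RInt_ge_0; [lra | apply Hex; lra | intros; apply Hp; lra]. }
  assert (I2 : 0 < RInt g c e).
  { apply RInt_gt_0; [lra | | intros; apply Hc; lra].
    intros u Hu. assert (Hb : ball t d u).
    { change (Rabs (u - t) < d). apply Rabs_def1; lra. }
    specialize (Hd u Hb). change (Rabs (g u - g t) < g t) in Hd.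
    apply Rabs_def2 in Hd. lra. }
  assert (I3 : 0 <= RInt g e b).
  { apply RInt_ge_0; [lra | apply Hex; lra | intros; apply Hp; lra]. }
  assert (E1 : RInt g a c + RInt g c e = RInt g a e)
    by (apply (RInt_Chasles g); apply Hex; lra).
  assert (E2 : RInt g a e + RInt g e b = RInt g a b)
    by (apply (RInt_Chasles g); apply Hex; lra).
  lra.
Qed.

(** * The Euler-Lagrange expression and the first variation *)

Definition cross3 (p q : R3) : R3 :=
  (c3_2 p * c3_3 q - c3_3 p * c3_2 q,
   c3_3 p * c3_1 q - c3_1 p * c3_3 q,
   c3_1 p * c3_2 q - c3_2 p * c3_1 q).

Ltac coords := unfold cross3, dot3, c3_1, c3_2, c3_3; simpl fst; simpl snd.

Lemma dot3_pos (p : R3) : p <> (0, 0, 0) -> 0 < dot3 p p.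
Proof.
  destruct p as [[x y] z]. coords. intros H.
  destruct (Req_dec x 0) as [-> |]; [| nra].
  destruct (Req_dec y 0) as [-> |]; [| nra].
  destruct (Req_dec z 0) as [-> |]; [now contradict H | nra].
Qed.

Lemma dot3_cross3 (p q : R3) :
  dot3 (cross3 p q) (cross3 p q) = dot3 p p * dot3 q q - dot3 p q ^ 2.
Proof. destruct p as [[p1 p2] p3], q as [[q1 q2] q3]. coords. ring. Qed.

(* Expands [r] in the orthogonal frame p, q, p x q, cleared of the denominator [dot3 q q]. *)
Lemma cross3_expansion (p q r : R3) :
  dot3 p p = 1 -> dot3 p q = 0 -> dot3 p r = 0 ->
  let k := dot3 r (cross3 p q) in
  k * c3_1 (cross3 p q) = dot3 q q * c3_1 r - dot3 q r * c3_1 q /\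
  k * c3_2 (cross3 p q) = dot3 q q * c3_2 r - dot3 q r * c3_2 q /\
  k * c3_3 (cross3 p q) = dot3 q q * c3_3 r - dot3 q r * c3_3 q.
Proof.
  destruct p as [[p1 p2] p3], q as [[q1 q2] q3], r as [[r1 r2] r3].
  coords. intros Hpp Hpq Hpr.
  set (pp := p1 * p1 + p2 * p2 + p3 * p3) in Hpp.
  set (pq := p1 * q1 + p2 * q2 + p3 * q3) in Hpq.
  set (pr := p1 * r1 + p2 * r2 + p3 * r3) in Hpr.
  set (qq := q1 * q1 + q2 * q2 + q3 * q3).
  set (qr := q1 * r1 + q2 * r2 + q3 * r3).
  (* The premise is an identity valid for all p, q, r, whose coefficients are cofactors of the Gram
     matrix; [ring] proves it with the products expanded, and the three constraints enter only
     here. *)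
  assert (G : forall ri pi qi ni k,
    k * ni = (pp * qq - pq * pq) * ri - (pr * qq - qr * pq) * pi - (qr * pp - pr * pq) * qi ->
    k * ni = qq * ri - qr * qi).
  { intros ri pi qi ni k ->. rewrite Hpp, Hpq, Hpr. ring. }
  split; [| split].
  - apply (G _ p1). unfold pp, pq, pr, qq, qr. ring.
  - apply (G _ p2). unfold pp, pq, pr, qq, qr. ring.
  - apply (G _ p3). unfold pp, pq, pr, qq, qr. ring.
Qed.

(** With respect to the unit normal n / |c'|, the rotated surface has principal curvatures <c'', n>
    / |c'|^3 along the meridian and - n_3 / (z |c'|) along the parallel. The expression is their sum
    multiplied by z |c'|^3. *)
Definition euler_lagrange (c : R -> R3) (t : R) : R :=
  let n := cross3 (c t) (deriv3 c t) in
  c3_3 (c t) * dot3 (deriv3 (deriv3 c) t) n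
  - c3_3 n * dot3 (deriv3 c t) (deriv3 c t).

Lemma deriv3_ext_loc (c e : R -> R3) (t : R) :
  locally t (fun u => c u = e u) -> deriv3 c t = deriv3 e t.
Proof.
  intros H. unfold deriv3.
  f_equal; [f_equal |]; apply Derive_ext_loc;
    apply filter_imp with (2 := H); now intros u ->.
Qed.

Lemma euler_lagrange_ext_loc (c e : R -> R3) (t : R) :
  locally t (fun u => c u = e u) -> euler_lagrange c t = euler_lagrange e t.
Proof.
  intros H. unfold euler_lagrange.
  rewrite (deriv3_ext_loc c e t H), (locally_singleton _ _ H).
  rewrite (deriv3_ext_loc (deriv3 c) (deriv3 e) t); [reflexivity |].
  (* For second derivatives the first ones must agree near t, not only at t. *)
  apply locally_locally in H. apply filter_imp with (2 := H).
  intros u Hu. now apply deriv3_ext_loc.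
Qed.

(* [z <c', xi> / |c'|] is the boundary term of the integration by parts. *)
Lemma first_variation_integrand (x y z x' y' z' p q r : R -> R)
    (t x2 y2 z2 p' q' r' : R) :
  is_derive x t (x' t) -> is_derive y t (y' t) -> is_derive z t (z' t) ->
  is_derive x' t x2 -> is_derive y' t y2 -> is_derive z' t z2 ->
  is_derive p t p' -> is_derive q t q' -> is_derive r t r' ->
  let c := (x t, y t, z t) in let c' := (x' t, y' t, z' t) in
  let c2 := (x2, y2, z2) in let xi := (p t, q t, r t) in
  let n := cross3 c c' in
  0 < dot3 c' c' -> dot3 c c = 1 -> dot3 c c' = 0 -> dot3 c xi = 0 ->
  is_derive
    (fun u => z u * (x' u * p u + y' u * q u + z' u * r u)
              / sqrt (x' u * x' u + y' u * y' u + z' u * z' u)) t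
    (r t * norm3 c' + z t * dot3 c' (p', q', r') / norm3 c'
     + dot3 xi n * (z t * dot3 c2 n - c3_3 n * dot3 c' c') / norm3 c' ^ 3).
Proof.
  intros Hx Hy Hz Hx' Hy' Hz' Hp Hq Hr c c' c2 xi n Hpos Hcc Hcc' Hcxi.
  evar_last.
  - apply @is_derive_div.
    + apply is_derive_Rmult; [exact Hz |].
      apply @is_derive_plus; [apply @is_derive_plus |]; apply is_derive_Rmult; eassumption.
    + apply is_derive_sqrt; [| exact Hpos].
      apply @is_derive_plus; [apply @is_derive_plus |]; apply is_derive_Rmult; eassumption.
    + apply Rgt_not_eq, sqrt_lt_R0, Hpos.
  - pose proof (cross3_expansion c c' xi Hcc Hcc' Hcxi) as (E1 & E2 & E3).
    fold n in E1, E2, E3.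
    unfold plus, mult, scal; simpl. unfold mult; simpl.
    fold c c'. change (c3_1 c * c3_2 c' - c3_2 c * c3_1 c') with (c3_3 n).
    set (S := sqrt (x' t * x' t + y' t * y' t + z' t * z' t)).
    assert (HS : 0 < S) by (apply sqrt_lt_R0, Hpos).
    assert (HSS : S * S = dot3 c' c') by (apply sqrt_sqrt; lra).
    change (norm3 c') with S.
    set (k := dot3 xi n) in *.
    (* Once multiplied by k, the expression involves n only through the vector k n. The expansion of
       xi then eliminates the cross product and leaves a rational identity in S. *)
    assert (E : k * (z t * dot3 c2 n - c3_3 n * dot3 c' c') =
      z t * (c3_1 c2 * (k * c3_1 n) + c3_2 c2 * (k * c3_2 n) + c3_3 c2 * (k * c3_3 n))
      - k * c3_3 n * dot3 c' c') by (unfold dot3; ring).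
    rewrite E, E1, E2, E3, <- HSS. clear E E1 E2 E3.
    clear HSS Hcc Hcc' Hcxi. clearbody S k.
    unfold c, c', c2, xi; coords.
    field. lra.
Qed.

Definition variation_field (Gamma : R -> R -> R3) (t : R) : R3 :=
  deriv3 (fun eps => Gamma eps t) 0.

Lemma smooth_near_2d_dot3 (F G : R -> R -> R3) (s t : R) :
  smooth_near3_2d F s t -> smooth_near3_2d G s t ->
  smooth_near_2d (fun u v => dot3 (F u v) (G u v)) s t.
Proof.
  intros (F1 & F2 & F3) (G1 & G2 & G3). unfold dot3. smooth_2d.
Qed.

Lemma smooth_near3_2d_cross3 (F G : R -> R -> R3) (s t : R) :
  smooth_near3_2d F s t -> smooth_near3_2d G s t ->
  smooth_near3_2d (fun u v => cross3 (F u v) (G u v)) s t.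
Proof.
  intros (F1 & F2 & F3) (G1 & G2 & G3).
  split; [| split]; unfold cross3; simpl; smooth_2d.
Qed.

Lemma smooth_near3_2d_deriv3 (F : R -> R -> R3) (s t : R) :
  smooth_near3_2d F s t -> smooth_near3_2d (fun u v => deriv3 (F u) v) s t.
Proof.
  intros (F1 & F2 & F3).
  split; [| split]; [now apply (smooth_near_2d_d2 _ _ _ F1) |
    now apply (smooth_near_2d_d2 _ _ _ F2) | now apply (smooth_near_2d_d2 _ _ _ F3)].
Qed.

Lemma smooth_near_2d_euler_lagrange (F : R -> R -> R3) (s t : R) :
  smooth_near3_2d F s t -> smooth_near_2d (fun u v => euler_lagrange (F u) v) s t.
Proof.
  intros HF.
  pose proof (smooth_near3_2d_deriv3 _ _ _ HF) as HF'.
  pose proof (smooth_near3_2d_deriv3 _ _ _ HF') as HF''.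
  pose proof (smooth_near3_2d_cross3 _ _ _ _ HF HF') as HN.
  unfold euler_lagrange.
  apply smooth_near_2d_minus; apply smooth_near_2d_mult;
    solve [now apply smooth_near_2d_dot3 | apply HF | apply HN].
Qed.

Lemma is_derive_dot3 (c e : R -> R3) (t : R) :
  (ex_derive (fun u => c3_1 (c u)) t /\ ex_derive (fun u => c3_2 (c u)) t /\
   ex_derive (fun u => c3_3 (c u)) t) ->
  (ex_derive (fun u => c3_1 (e u)) t /\ ex_derive (fun u => c3_2 (e u)) t /\
   ex_derive (fun u => c3_3 (e u)) t) ->
  is_derive (fun u => dot3 (c u) (e u)) t (dot3 (deriv3 c t) (e t) + dot3 (c t) (deriv3 e t)).
Proof.
  intros (C1 & C2 & C3) (E1 & E2 & E3). evar_last.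
  - apply @is_derive_plus; [apply @is_derive_plus |]; apply is_derive_Rmult;
      apply Derive_correct; assumption.
  - unfold plus; simpl. unfold dot3, deriv3, c3_1, c3_2, c3_3; simpl. ring.
Qed.

(** Used in both variables of a variation: in t it makes the velocity tangent to the sphere, in eps
    the variation field. *)
Lemma dot3_deriv3_sphere (c : R -> R3) (t : R) :
  (ex_derive (fun u => c3_1 (c u)) t /\ ex_derive (fun u => c3_2 (c u)) t /\
   ex_derive (fun u => c3_3 (c u)) t) ->
  locally t (fun u => dot3 (c u) (c u) = 1) -> dot3 (c t) (deriv3 c t) = 0.
Proof.
  intros Hc H1.
  pose proof (is_derive_unique _ _ _ (is_derive_dot3 c c t Hc Hc)) as E.
  rewrite (Derive_ext_loc _ (fun _ => 1)) in E by exact H1.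
  rewrite Derive_const in E. unfold dot3 in *. lra.
Qed.

Lemma smooth_near3_2d_ex_derive_1 (F : R -> R -> R3) (s t : R) :
  smooth_near3_2d F s t ->
  ex_derive (fun u => c3_1 (F u t)) s /\ ex_derive (fun u => c3_2 (F u t)) s /\
  ex_derive (fun u => c3_3 (F u t)) s.
Proof.
  intros (F1 & F2 & F3).
  split; [| split]; eexists;
    [apply (smooth_near_2d_is_derive_1 _ _ _ F1) |
     apply (smooth_near_2d_is_derive_1 _ _ _ F2) |
     apply (smooth_near_2d_is_derive_1 _ _ _ F3)].
Qed.

Lemma smooth_near3_2d_ex_derive_2 (F : R -> R -> R3) (s t : R) :
  smooth_near3_2d F s t ->
  ex_derive (fun v => c3_1 (F s v)) t /\ ex_derive (fun v => c3_2 (F s v)) t /\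
  ex_derive (fun v => c3_3 (F s v)) t.
Proof.
  intros (F1 & F2 & F3).
  split; [| split]; eexists;
    [apply (smooth_near_2d_is_derive_2 _ _ _ F1) |
     apply (smooth_near_2d_is_derive_2 _ _ _ F2) |
     apply (smooth_near_2d_is_derive_2 _ _ _ F3)].
Qed.

Lemma locally_Rabs_lt (d : R) : 0 < d -> locally 0 (fun e => Rabs e < d).
Proof.
  intros Hd. exists (mkposreal d Hd). intros e He.
  change (Rabs (e - 0) < d) in He. now rewrite Rminus_0_r in He.
Qed.

(** After differentiation under the integral sign, the integral of d2 B, which is zero because the
    end points are fixed, is subtracted. The integrands are then compared only at interior times,
    near which the curve lies on the sphere. *)
Lemma first_variation (a b delta : R) (Gamma : R -> R -> R3) :
  a < b -> 0 < delta ->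
  (forall eps t, Rabs eps < delta -> a <= t <= b -> smooth_near3_2d Gamma eps t) ->
  (forall t, a <= t <= b -> deriv3 (Gamma 0) t <> (0, 0, 0)) ->
  (forall eps t, Rabs eps < delta -> a < t < b -> dot3 (Gamma eps t) (Gamma eps t) = 1) ->
  (forall eps, Rabs eps < delta -> Gamma eps a = Gamma 0 a /\ Gamma eps b = Gamma 0 b) ->
  is_derive (fun eps => extrinsic_energy 0 a b (Gamma eps)) 0
    (RInt (fun t => - (dot3 (variation_field Gamma t) (cross3 (Gamma 0 t) (deriv3 (Gamma 0) t))
                       * euler_lagrange (Gamma 0) t / norm3 (deriv3 (Gamma 0) t) ^ 3)) a b).
Proof.
  intros Hab Hdelta Hsm Hreg Hsph Hend.
  set (X := fun u v => c3_1 (Gamma u v)).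
  set (Y := fun u v => c3_2 (Gamma u v)).
  set (Z := fun u v => c3_3 (Gamma u v)).
  set (Q := fun u v => dot3 (deriv3 (Gamma u) v) (deriv3 (Gamma u) v)).
  (* The summand 0 is lambda; it keeps F convertible to the integrand of [extrinsic_energy]. *)
  set (F := fun u v => (Z u v + 0) * sqrt (Q u v)).
  assert (Z0 : Rabs 0 < delta) by now rewrite Rabs_R0.
  assert (HQ : forall eps t, Rabs eps < delta -> a <= t <= b -> smooth_near_2d Q eps t).
  { intros eps t He Ht.
    now apply smooth_near_2d_dot3; apply smooth_near3_2d_deriv3, Hsm. }
  assert (HQ0 : forall t, a <= t <= b -> 0 < Q 0 t)
    by (intros t Ht; now apply dot3_pos, Hreg).
  (* Regularity is known at eps = 0 only; for |eps| < d' the nearby curves are regular too, so that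
     the square root in F is smooth. *)
  destruct (segment_positivity Q a b 0) as [d' Hd'].
  { intros t Ht. now apply smooth_near_2d_continuity, HQ. }
  { exact HQ0. }
  assert (HF : forall eps t, Rabs eps < delta -> Rabs eps < d' -> a <= t <= b ->
                 smooth_near_2d F eps t).
  { intros eps t He He' Ht. destruct (Hsm eps t He Ht) as (_ & _ & HZ).
    apply smooth_near_2d_mult.
    - apply smooth_near_2d_plus; [exact HZ | apply smooth_near_2d_const].
    - apply smooth_near_2d_sqrt; [apply Hd'; [rewrite Rminus_0_r |] |]; auto. }
  pose proof (cond_pos d') as Hd'0.
  assert (HF0 : forall t, a <= t <= b -> smooth_near_2d F 0 t)
    by (intros t Ht; apply HF; auto; now rewrite Rabs_R0).
  assert (HD : is_derive (fun eps => RInt (fun t => F eps t) a b) 0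
                 (RInt (fun t => d1 F 0 t) a b)).
  { apply (is_derive_RInt_param F).
    - pose proof (filter_and _ _ (locally_Rabs_lt _ Hdelta) (locally_Rabs_lt _ Hd'0)) as H.
      apply filter_imp with (2 := H). intros e [He He'] t.
      rewrite Rmin_left, Rmax_right by lra. intros Ht.
      eexists. apply smooth_near_2d_is_derive_1. now apply HF.
    - intros t. rewrite Rmin_left, Rmax_right by lra. intros Ht.
      apply (smooth_near_2d_continuity (d1 F)), smooth_near_2d_d1, HF0, Ht.
    - pose proof (filter_and _ _ (locally_Rabs_lt _ Hdelta) (locally_Rabs_lt _ Hd'0)) as H.
      apply filter_imp with (2 := H). intros e [He He'].
      apply @ex_RInt_continuous. intros t.
      rewrite Rmin_left, Rmax_right by lra. intros Ht.
      now apply smooth_near_2d_continuous_2, HF. }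
  evar_last; [exact HD |]. clear HD.
  set (B := fun u v => Z u v * (d2 X u v * d1 X u v + d2 Y u v * d1 Y u v
                                + d2 Z u v * d1 Z u v) / sqrt (Q u v)).
  assert (HB : forall t, a <= t <= b -> smooth_near_2d B 0 t).
  { intros t Ht. destruct (Hsm 0 t Z0 Ht) as (HX & HY & HZ).
    apply smooth_near_2d_div.
    - now apply Rgt_not_eq, sqrt_lt_R0, HQ0.
    - smooth_2d.
    - apply smooth_near_2d_sqrt; auto. }
  assert (IB : is_RInt (fun t => d2 B 0 t) a b 0).
  { assert (Hconst : forall f : R -> R, locally 0 (fun e => f e = f 0) -> Derive f 0 = 0).
    { intros f Hf. rewrite (Derive_ext_loc _ (fun _ => f 0)) by exact Hf.
      apply Derive_const. }
    (* Where the variation is fixed its eps-derivatives vanish, and B is linear in them. *)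
    assert (B0 : forall t, (forall eps, Rabs eps < delta -> Gamma eps t = Gamma 0 t) ->
                   B 0 t = 0).
    { intros t Ht. unfold B, d1.
      assert (HL : locally 0 (fun e => Gamma e t = Gamma 0 t))
        by (apply filter_imp with (2 := locally_Rabs_lt _ Hdelta); exact Ht).
      rewrite !Hconst by (apply filter_imp with (2 := HL); unfold X, Y, Z; now intros e ->).
      unfold Rdiv. ring. }
    evar_last.
    - apply (is_RInt_derive (fun t => B 0 t)); intros t;
        rewrite Rmin_left, Rmax_right by lra; intros Ht.
      + now apply smooth_near_2d_is_derive_2, HB.
      + now apply smooth_near_2d_continuous_2, smooth_near_2d_d2, HB.
    - rewrite !B0; [apply Rminus_diag; reflexivity | |]; intros; now apply Hend. }
  assert (IF : ex_RInt (fun t => d1 F 0 t) a b).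
  { apply @ex_RInt_continuous. intros t.
    rewrite Rmin_left, Rmax_right by lra. intros Ht.
    now apply smooth_near_2d_continuous_2, smooth_near_2d_d1, HF0. }
  transitivity (RInt (fun t => minus (d1 F 0 t) (d2 B 0 t)) a b).
  { rewrite (RInt_minus (fun t => d1 F 0 t) (fun t => d2 B 0 t));
      [| exact IF | eexists; exact IB].
    rewrite (is_RInt_unique _ _ _ _ IB). symmetry. apply Rminus_0_r. }
  apply RInt_ext. intros t. rewrite Rmin_left, Rmax_right by lra. intros Ht.
  assert (Ht' : a <= t <= b) by lra.
  destruct (Hsm 0 t Z0 Ht') as (HX & HY & HZ). fold X in HX. fold Y in HY. fold Z in HZ.
  assert (HB' : is_derive (fun v => B 0 v) t
    (d1 Z 0 t * norm3 (deriv3 (Gamma 0) t)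
     + Z 0 t * dot3 (deriv3 (Gamma 0) t) (d2 (d1 X) 0 t, d2 (d1 Y) 0 t, d2 (d1 Z) 0 t)
       / norm3 (deriv3 (Gamma 0) t)
     + dot3 (variation_field Gamma t) (cross3 (Gamma 0 t) (deriv3 (Gamma 0) t))
       * euler_lagrange (Gamma 0) t / norm3 (deriv3 (Gamma 0) t) ^ 3)).
  { assert (Hpair : Gamma 0 t = (X 0 t, Y 0 t, Z 0 t))
      by (unfold X, Y, Z; destruct (Gamma 0 t) as [[? ?] ?]; reflexivity).
    unfold euler_lagrange. rewrite Hpair.
    apply (first_variation_integrand (X 0) (Y 0) (Z 0) (d2 X 0) (d2 Y 0) (d2 Z 0)
             (d1 X 0) (d1 Y 0) (d1 Z 0));
      try (apply smooth_near_2d_is_derive_2; smooth_2d).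
    - exact (HQ0 t Ht').
    - rewrite <- Hpair. now apply Hsph.
    - rewrite <- Hpair. apply (dot3_deriv3_sphere (Gamma 0)).
      + now apply smooth_near3_2d_ex_derive_2, Hsm.
      + apply (locally_open_interval a b); auto.
    - rewrite <- Hpair. apply (dot3_deriv3_sphere (fun e => Gamma e t)).
      + now apply smooth_near3_2d_ex_derive_1, Hsm.
      + apply filter_imp with (2 := locally_Rabs_lt _ Hdelta). auto. }
  rewrite (is_derive_unique _ _ _ HB' : d2 B 0 t = _). clear HB'.
  assert (HF1 : is_derive (fun u => F u t) 0
    (d1 Z 0 t * norm3 (deriv3 (Gamma 0) t)
     + Z 0 t * dot3 (deriv3 (Gamma 0) t) (d2 (d1 X) 0 t, d2 (d1 Y) 0 t, d2 (d1 Z) 0 t)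
       / norm3 (deriv3 (Gamma 0) t))).
  { rewrite <- !smooth_near_2d_Schwarz by assumption.
    assert (HE : ex_derive (fun u => c3_1 (deriv3 (Gamma u) t)) 0 /\
                 ex_derive (fun u => c3_2 (deriv3 (Gamma u) t)) 0 /\
                 ex_derive (fun u => c3_3 (deriv3 (Gamma u) t)) 0).
    { apply (smooth_near3_2d_ex_derive_1 (fun u v => deriv3 (Gamma u) v)).
      now apply smooth_near3_2d_deriv3, Hsm. }
    set (W := (d1 (d2 X) 0 t, d1 (d2 Y) 0 t, d1 (d2 Z) 0 t)).
    set (D := deriv3 (Gamma 0) t).
    assert (DQ : is_derive (fun u => Q u t) 0 (dot3 W D + dot3 D W))
      by exact (is_derive_dot3 _ _ _ HE HE).
    evar_last.
    - apply is_derive_Rmult.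
      + apply @is_derive_plus; [now apply smooth_near_2d_is_derive_1 | apply @is_derive_const].
      + apply is_derive_sqrt; [exact DQ | exact (HQ0 t Ht')].
    - cbv beta. change (sqrt (Q 0 t)) with (norm3 D).
      assert (HL : 0 < norm3 D) by apply sqrt_lt_R0, HQ0, Ht'.
      unfold plus, zero; simpl.
      set (L := norm3 D) in *. clearbody L D W.
      unfold dot3. field. lra. }
  rewrite (is_derive_unique _ _ _ HF1 : d1 F 0 t = _).
  unfold minus, plus, opp; simpl. ring.
Qed.

(** * Mean curvature of the surface of revolution *)

(** The rotation by s is linear and independent of t, so it commutes with differentiation in t.
    Iterating the lemma gives the second derivative. *)
Lemma partial_t_surface (c : R -> R3) (t s : R) :
  partial_t (surface_of_revolution c) t s = surface_of_revolution (deriv3 c) t s.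
Proof.
  unfold partial_t, deriv4, surface_of_revolution, rot, incl, c4_1, c4_2, c4_3, c4_4;
    simpl.
  rewrite (Derive_ext (fun u => cos s * _ - _) (fun u => cos s * c3_3 (c u)))
    by (intros; ring).
  rewrite (Derive_ext (fun u => sin s * _ + _) (fun u => sin s * c3_3 (c u)))
    by (intros; ring).
  rewrite !Derive_scal. change (Derive (fun u => c3_3 (c u)) t) with (c3_3 (deriv3 c t)).
  f_equal; [f_equal |]; ring.
Qed.

Lemma partial_t_ext (Phi Psi : R -> R -> R4) (t s : R) :
  (forall u, Phi u s = Psi u s) -> partial_t Phi t s = partial_t Psi t s.
Proof.
  intros H. unfold partial_t, deriv4.
  f_equal; [f_equal; [f_equal |] |]; apply Derive_ext; intros u; now rewrite H.
Qed.

Lemma partial_s_surface (c : R -> R3) (t s : R) :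
  partial_s (surface_of_revolution c) t s =
  (0, 0, - sin s * c3_3 (c t), cos s * c3_3 (c t)).
Proof.
  unfold partial_s, deriv4, surface_of_revolution, rot, incl, c4_1, c4_2, c4_3, c4_4;
    simpl.
  rewrite !Derive_const.
  f_equal; [f_equal |]; apply is_derive_unique; auto_derive; trivial; ring.
Qed.

Lemma partial_t_partial_s_surface (c : R -> R3) (t s : R) :
  partial_t (partial_s (surface_of_revolution c)) t s =
  (0, 0, - sin s * c3_3 (deriv3 c t), cos s * c3_3 (deriv3 c t)).
Proof.
  rewrite (partial_t_ext (partial_s (surface_of_revolution c))
    (fun u v => (0, 0, - sin v * c3_3 (c u), cos v * c3_3 (c u))))
    by (intros; apply partial_s_surface).
  unfold partial_t, deriv4, c4_1, c4_2, c4_3, c4_4; simpl.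
  now rewrite !Derive_const, !Derive_scal.
Qed.

Lemma partial_s_partial_s_surface (c : R -> R3) (t s : R) :
  partial_s (partial_s (surface_of_revolution c)) t s =
  (0, 0, - cos s * c3_3 (c t), - sin s * c3_3 (c t)).
Proof.
  unfold partial_s at 1, deriv4.
  assert (E : forall u, partial_s (surface_of_revolution c) t u =
                (0, 0, - sin u * c3_3 (c t), cos u * c3_3 (c t)))
    by (intros; apply partial_s_surface).
  rewrite (Derive_ext _ (fun _ => 0)) by (intros u; now rewrite E).
  rewrite (Derive_ext (fun u => c4_2 _) (fun _ => 0)) by (intros u; now rewrite E).
  rewrite (Derive_ext (fun u => c4_3 _) (fun u => - sin u * c3_3 (c t)))
    by (intros u; now rewrite E).
  rewrite (Derive_ext (fun u => c4_4 _) (fun u => cos u * c3_3 (c t)))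
    by (intros u; now rewrite E).
  rewrite !Derive_const.
  f_equal; [f_equal |]; apply is_derive_unique; auto_derive; trivial; ring.
Qed.

(** Rotating N back by - s gives nu together with a fourth component, which is zero: N is orthogonal
    to the parallel, and z > 0. This reduces the second fundamental form to data of the curve in
    R^3. *)
Lemma mean_curvature_surface (c : R -> R3) (t s : R) (N : R4) :
  let m := cos s * c4_3 N + sin s * c4_4 N in
  let nu := (c4_1 N, c4_2 N, m) in
  0 < c3_3 (c t) ->
  is_unit_normal (surface_of_revolution c) t s N ->
  dot3 (c t) nu = 0 /\ dot3 (deriv3 c t) nu = 0 /\
  mean_curvature (surface_of_revolution c) N t s =
  c3_3 (c t) *
    (c3_3 (c t) * dot3 (deriv3 (deriv3 c) t) nu - m * dot3 (deriv3 c t) (deriv3 c t))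
  / (2 * (dot3 (deriv3 c t) (deriv3 c t) * c3_3 (c t) ^ 2)).
Proof.
  intros m nu Hz (_ & H0 & Ht & Hs).
  rewrite partial_t_surface in Ht. rewrite partial_s_surface in Hs.
  unfold mean_curvature. cbv zeta.
  rewrite (partial_t_ext (partial_t (surface_of_revolution c))
             (surface_of_revolution (deriv3 c)))
    by (intros; apply partial_t_surface).
  rewrite !partial_t_surface, !partial_s_surface, partial_t_partial_s_surface,
    partial_s_partial_s_surface.
  pose proof (sin2_cos2 s) as Hsc. unfold Rsqr in Hsc.
  destruct N as [[[N1 N2] N3] N4].
  subst m nu.
  unfold surface_of_revolution in *.
  set (p := c t) in *. set (q := deriv3 c t) in *. set (r := deriv3 (deriv3 c) t).
  clearbody p q r.
  unfold rot, incl, dot4, c4_1, c4_2, c4_3, c4_4 in *; simpl in *.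
  assert (Hs' : - sin s * N3 + cos s * N4 = 0).
  { apply Rmult_eq_reg_l with (c3_3 p); lra. }
  unfold dot3; simpl. unfold c3_1, c3_2, c3_3 in *; simpl in *.
  set (S := sin s) in *. set (C := cos s) in *. clearbody S C.
  split; [| split].
  - lra.
  - lra.
  - f_equal.
    (* The numerator is arranged so that sines and cosines occur in S S + C C, in m, in the
       vanishing component of the normal and in F, which cancels. *)
    + transitivity (snd p * (snd p * (fst (fst r) * N1 + snd (fst r) * N2
          + snd r * (C * N3 + S * N4)) * (S * S + C * C) - (C * N3 + S * N4) *
          (fst (fst q) * fst (fst q) + snd (fst q) * snd (fst q)
           + snd q * snd q * (S * S + C * C)) * 1)
          - 2 * snd q * (- S * N3 + C * N4) * (snd q * (C * - S * snd p + S * C * snd p))).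
      * ring.
      * rewrite Hsc, Hs'. ring.
    + transitivity (2 * ((fst (fst q) * fst (fst q) + snd (fst q) * snd (fst q)
           + snd q * snd q * (S * S + C * C)) * (snd p ^ 2 * (S * S + C * C)))).
      * ring.
      * rewrite Hsc. ring.
Qed.

(** The length is right because |n|^2 = |c|^2 |c'|^2 - <c, c'>^2 = |c'|^2. At s = 0 the parallel
    points along the fourth axis, hence the last coordinate 0. *)
Lemma unit_normal_surface (c : R -> R3) (t : R) :
  dot3 (c t) (c t) = 1 -> dot3 (c t) (deriv3 c t) = 0 -> 0 < dot3 (deriv3 c t) (deriv3 c t) ->
  let n := cross3 (c t) (deriv3 c t) in
  let l := norm3 (deriv3 c t) in
  is_unit_normal (surface_of_revolution c) t 0
    (c3_1 n / l, c3_2 n / l, c3_3 n / l, 0).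
Proof.
  intros Hcc Hcc' Hpos n l.
  assert (Hl : 0 < l) by apply sqrt_lt_R0, Hpos.
  assert (Hll : l * l = dot3 (deriv3 c t) (deriv3 c t)) by (apply sqrt_sqrt; lra).
  unfold is_unit_normal. rewrite partial_t_surface, partial_s_surface.
  unfold surface_of_revolution.
  set (p := c t) in *. set (q := deriv3 c t) in *.
  assert (Hnn : dot3 n n = l * l).
  { unfold n. rewrite dot3_cross3, Hcc, Hcc', Hll. ring. }
  assert (Hn1 : dot3 p n = 0) by (unfold n; coords; ring).
  assert (Hn2 : dot3 q n = 0) by (unfold n; coords; ring).
  clearbody n l p q.
  unfold rot, incl, dot4, dot3, c4_1, c4_2, c4_3, c4_4 in *; simpl.
  rewrite cos_0, sin_0.
  split; [| split; [| split]].
  - transitivity ((c3_1 n * c3_1 n + c3_2 n * c3_2 n + c3_3 n * c3_3 n) / (l * l));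
      [field; lra | rewrite Hnn; field; lra].
  - transitivity ((c3_1 p * c3_1 n + c3_2 p * c3_2 n + c3_3 p * c3_3 n) / l);
      [field; lra | rewrite Hn1; field; lra].
  - transitivity ((c3_1 q * c3_1 n + c3_2 q * c3_2 n + c3_3 q * c3_3 n) / l);
      [field; lra | rewrite Hn2; field; lra].
  - ring.
Qed.

(** As K does not depend on s, minimality is tested at s = 0 on the explicit normal. Conversely, for
    any unit normal N the vector nu is orthogonal to c and c', so |c'|^2 nu = <nu, n> n and the mean
    curvature is a multiple of K. *)
Lemma minimal_iff_euler_lagrange (a b : R) (c : R -> R3) :
  (forall t, a <= t <= b -> dot3 (c t) (c t) = 1) ->
  (forall t, a <= t <= b -> 0 < c3_3 (c t)) ->
  (forall t, a <= t <= b -> dot3 (c t) (deriv3 c t) = 0) ->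
  (forall t, a <= t <= b -> 0 < dot3 (deriv3 c t) (deriv3 c t)) ->
  minimal_in_S3 a b (surface_of_revolution c) <->
  (forall t, a <= t <= b -> euler_lagrange c t = 0).
Proof.
  intros Hcc Hz Hcc' Hpos. split.
  - intros Hmin t Ht. specialize (Hcc t Ht). specialize (Hz t Ht).
    specialize (Hcc' t Ht). specialize (Hpos t Ht).
    pose proof (unit_normal_surface c t Hcc Hcc' Hpos) as HN. cbv zeta in HN.
    destruct (mean_curvature_surface c t 0 _ Hz HN) as (_ & _ & HH).
    rewrite (Hmin t 0 Ht _ HN), cos_0, sin_0 in HH. clear HN.
    assert (Hl : 0 < norm3 (deriv3 c t)) by apply sqrt_lt_R0, Hpos.
    unfold euler_lagrange. cbv zeta in HH |- *.
    set (n := cross3 (c t) (deriv3 c t)) in *.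
    set (l := norm3 (deriv3 c t)) in *.
    set (LL := dot3 (deriv3 c t) (deriv3 c t)) in *.
    set (r := deriv3 (deriv3 c) t) in *. set (p := c t) in *.
    clearbody n l LL r p.
    unfold c4_1, c4_2, c4_3, c4_4 in HH; simpl in HH.
    (* The mean curvature, zero by [HH], is multiplied by 2 |c'|^2 z l, which clears the
       denominators and returns K. *)
    transitivity ((c3_3 p * (c3_3 p *
      dot3 r (c3_1 n / l, c3_2 n / l, 1 * (c3_3 n / l) + 0 * 0)
      - (1 * (c3_3 n / l) + 0 * 0) * LL) / (2 * (LL * (c3_3 p * (c3_3 p * 1)))))
      * (2 * LL * c3_3 p * l)).
    + unfold dot3; simpl. unfold c3_1, c3_2, c3_3 in *; simpl. field.
      split; [| split]; lra.
    + rewrite <- HH. ring.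
  - intros HEL t s Ht N HN. specialize (Hcc t Ht). specialize (Hz t Ht).
    specialize (Hcc' t Ht). specialize (Hpos t Ht). specialize (HEL t Ht).
    destruct (mean_curvature_surface c t s N Hz HN) as (H1 & H2 & ->).
    set (m := cos s * c4_3 N + sin s * c4_4 N) in *.
    set (nu := (c4_1 N, c4_2 N, m)) in *.
    destruct (cross3_expansion (c t) (deriv3 c t) nu Hcc Hcc' H1) as (E1 & E2 & E3).
    rewrite H2 in E1, E2, E3.
    unfold euler_lagrange in HEL. cbv zeta in HEL.
    set (n := cross3 (c t) (deriv3 c t)) in *.
    set (LL := dot3 (deriv3 c t) (deriv3 c t)) in *.
    set (r := deriv3 (deriv3 c) t) in *.
    set (k := dot3 nu n) in *.
    assert (E : LL * (c3_3 (c t) * dot3 r nu - m * LL) = 0).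
    { change m with (c3_3 nu).
      transitivity (k * (c3_3 (c t) * dot3 r n - c3_3 n * LL)).
      - unfold dot3.
        transitivity (c3_3 (c t) * (c3_1 r * (k * c3_1 n) + c3_2 r * (k * c3_2 n)
          + c3_3 r * (k * c3_3 n)) - (k * c3_3 n) * LL); [| ring].
        rewrite E1, E2, E3. ring.
      - rewrite HEL. ring. }
    apply Rmult_integral in E. destruct E as [E | E]; [lra |].
    rewrite E. unfold Rdiv. ring.
Qed.

(** * The normal variation *)

Lemma smooth_near3_2d_lift (c : R -> R3) (s t : R) :
  smooth_near3 c t -> smooth_near3_2d (fun _ => c) s t.
Proof.
  intros (H1 & H2 & H3). split; [| split]; now apply smooth_near_2d_lift.
Qed.

(** The constraint can be differentiated in the open interval only, since the curve may leave the
    sphere outside [a, b]; continuity gives the end points. *)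
Lemma dot3_deriv3_sphere_on (a b : R) (c : R -> R3) :
  a < b -> (forall t, a <= t <= b -> smooth_near3 c t) ->
  (forall t, a <= t <= b -> dot3 (c t) (c t) = 1) ->
  forall t, a <= t <= b -> dot3 (c t) (deriv3 c t) = 0.
Proof.
  intros Hab Hs H1 t Ht.
  apply (eq_0_on_closed_interval (fun u => dot3 (c u) (deriv3 c u)) a b); auto.
  - intros u Hu. apply dot3_deriv3_sphere.
    + apply (smooth_near3_2d_ex_derive_2 (fun _ => c) 0), smooth_near3_2d_lift, Hs; lra.
    + apply (locally_open_interval a b); [| exact Hu]. intros v Hv. apply H1; lra.
  - pose proof (smooth_near3_2d_lift c 0 t (Hs t Ht)) as HG.
    apply (smooth_near_2d_continuous_2 (fun _ v => dot3 (c v) (deriv3 c v)) 0).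
    apply (smooth_near_2d_dot3 (fun _ => c) (fun _ => deriv3 c)); [exact HG |].
    exact (smooth_near3_2d_deriv3 _ _ _ HG).
Qed.

(* The rational parametrization of the great circle through [c t] with direction
   the normal of [c], at the parameter [eps * phi t]: it stays on the sphere,
   and only sums, products and an inverse are needed. *)
Definition normal_variation (c : R -> R3) (phi : R -> R) (eps t : R) : R3 :=
  let n := cross3 (c t) (deriv3 c t) in
  let q := (eps * phi t) ^ 2 * dot3 (deriv3 c t) (deriv3 c t) in
  (((1 - q) * c3_1 (c t) + 2 * (eps * phi t) * c3_1 n) / (1 + q),
   ((1 - q) * c3_2 (c t) + 2 * (eps * phi t) * c3_2 n) / (1 + q),
   ((1 - q) * c3_3 (c t) + 2 * (eps * phi t) * c3_3 n) / (1 + q)).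

Lemma normal_variation_denominator (c : R -> R3) (phi : R -> R) (eps t : R) :
  0 < 1 + (eps * phi t) ^ 2 * dot3 (deriv3 c t) (deriv3 c t).
Proof.
  assert (0 <= dot3 (deriv3 c t) (deriv3 c t)) by (unfold dot3; nra).
  pose proof (pow2_ge_0 (eps * phi t)). nra.
Qed.

(** As c and n are orthogonal and |n| = |c'|, the squared length of the numerator is (1 - q)^2 + 4 q
    = (1 + q)^2. *)
Lemma normal_variation_sphere (c : R -> R3) (phi : R -> R) (eps t : R) :
  dot3 (c t) (c t) = 1 -> dot3 (c t) (deriv3 c t) = 0 ->
  dot3 (normal_variation c phi eps t) (normal_variation c phi eps t) = 1.
Proof.
  intros Hcc Hcc'. pose proof (normal_variation_denominator c phi eps t) as Hq.
  unfold normal_variation. cbv zeta. set (d := eps * phi t) in *. clearbody d.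
  set (p := c t) in *. set (p' := deriv3 c t) in *. set (q := d ^ 2 * dot3 p' p') in *.
  set (n := cross3 p p').
  assert (Hpn : dot3 p n = 0) by (unfold n; coords; ring).
  assert (Hnn : dot3 n n = dot3 p' p').
  { unfold n. rewrite dot3_cross3, Hcc, Hcc'. ring. }
  transitivity (((1 - q) ^ 2 * dot3 p p + 4 * d * (1 - q) * dot3 p n + 4 * d ^ 2 * dot3 n n)
                / (1 + q) ^ 2).
  - clearbody q n. coords. field. lra.
  - rewrite Hcc, Hpn, Hnn. replace (4 * d ^ 2 * dot3 p' p') with (4 * q) by (unfold q; ring).
    clearbody q. field. lra.
Qed.

(** Serves both eps = 0 and the end points, where phi vanishes. *)
Lemma normal_variation_at_zero (c : R -> R3) (phi : R -> R) (eps t : R) :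
  eps * phi t = 0 -> normal_variation c phi eps t = c t.
Proof.
  intros H0. unfold normal_variation. cbv zeta. rewrite H0.
  destruct (c t) as [[x y] z]. unfold c3_1 at 1, c3_2 at 1, c3_3 at 1; simpl fst; simpl snd.
  f_equal; [f_equal |]; field.
Qed.

(** The quantity q is of second order in eps, so only the linear term 2 eps phi n contributes. *)
Lemma normal_variation_field (c : R -> R3) (phi : R -> R) (t : R) :
  let n := cross3 (c t) (deriv3 c t) in
  variation_field (normal_variation c phi) t =
  (2 * phi t * c3_1 n, 2 * phi t * c3_2 n, 2 * phi t * c3_3 n).
Proof.
  assert (H : forall x n s l, is_derive
    (fun eps => ((1 - (eps * s) ^ 2 * l) * x + 2 * (eps * s) * n) / (1 + (eps * s) ^ 2 * l))
    0 (2 * s * n)).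
  { intros x n s l. auto_derive; [| field]; rewrite ?Rmult_0_l; simpl; lra. }
  intros n. unfold variation_field, deriv3 at 1.
  f_equal; [f_equal |]; apply is_derive_unique, H.
Qed.

Lemma smooth_near3_2d_normal_variation (c : R -> R3) (phi : R -> R) (s t : R) :
  smooth_near3_2d (fun _ => c) s t -> smooth_near_2d (fun _ => phi) s t ->
  smooth_near3_2d (normal_variation c phi) s t.
Proof.
  intros Hc Hphi.
  pose proof (smooth_near3_2d_deriv3 _ _ _ Hc) as Hc'.
  pose proof (smooth_near3_2d_cross3 _ _ _ _ Hc Hc') as (N1 & N2 & N3).
  pose proof (smooth_near_2d_dot3 _ _ _ _ Hc' Hc') as HL.
  destruct Hc as (C1 & C2 & C3).
  pose proof (normal_variation_denominator c phi s t) as Hq.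
  split; [| split]; apply smooth_near_2d_div; try (now apply Rgt_not_eq); smooth_2d.
Qed.

(** * Equivalence of minimality and criticality for the energy *)

Theorem corollary2p7 :
  forall (a b : R) (gamma : R -> R3),
    a < b ->
    smooth_regular_curve a b gamma ->
    (forall t, a <= t <= b -> open_hemisphere (gamma t)) ->
    (minimal_in_S3 a b (surface_of_revolution gamma) <->
     extrinsic_spherical_catenary 0 a b gamma).
Proof.
  intros a b gamma Hab Hreg Hhem.
  assert (Hs : forall t, a <= t <= b -> smooth_near3 gamma t) by (intros t Ht; apply Hreg, Ht).
  assert (Hs2 : forall s t, a <= t <= b -> smooth_near3_2d (fun _ => gamma) s t)
    by (intros; now apply smooth_near3_2d_lift, Hs).
  assert (Hsph : forall t, a <= t <= b -> dot3 (gamma t) (gamma t) = 1)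
    by (intros t Ht; apply Hhem, Ht).
  assert (Hz : forall t, a <= t <= b -> 0 < c3_3 (gamma t)) by (intros t Ht; apply Hhem, Ht).
  assert (Hpos : forall t, a <= t <= b -> 0 < dot3 (deriv3 gamma t) (deriv3 gamma t))
    by (intros t Ht; apply dot3_pos, Hreg, Ht).
  pose proof (dot3_deriv3_sphere_on a b gamma Hab Hs Hsph) as Horth.
  rewrite (minimal_iff_euler_lagrange a b gamma Hsph Hz Horth Hpos).
  split.
  - intros HEL delta Gamma Hdelta (Hsm & H0 & Hend).
    assert (Z0 : Rabs 0 < delta) by now rewrite Rabs_R0.
    assert (Hloc : forall t, a < t < b -> locally t (fun u => Gamma 0 u = gamma u)).
    { intros t Ht. apply (locally_open_interval a b); [| exact Ht].
      intros u Hu. apply H0. lra. }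
    (* Since Gamma 0 and gamma agree on [a, b] only, equality of their derivatives at a and b needs
       the smoothness of both. *)
    assert (Hd0 : forall t, a <= t <= b -> deriv3 (Gamma 0) t = deriv3 gamma t).
    { assert (E : forall f g : R -> R -> R,
        (forall t, a <= t <= b -> smooth_near_2d f 0 t) ->
        (forall t, a <= t <= b -> smooth_near_2d g 0 t) ->
        (forall t, a <= t <= b -> f 0 t = g 0 t) ->
        forall t, a <= t <= b -> d2 f 0 t = d2 g 0 t).
      { intros f g Hf Hg Hfg t Ht. apply Rminus_diag_uniq.
        rewrite <- (is_derive_unique (fun v => f 0 v - g 0 v) t (d2 f 0 t - d2 g 0 t)).
        - apply (d2_eq_0_on_closed_interval (fun u v => f u v - g u v) a b); auto.
          + intros u Hu. apply smooth_near_2d_minus; auto.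
          + intros u Hu. apply Rminus_diag_eq, Hfg. lra.
        - apply @is_derive_minus; apply smooth_near_2d_is_derive_2; auto. }
      intros t Ht. unfold deriv3. f_equal; [f_equal |].
      - apply (E (fun u v => c3_1 (Gamma u v)) (fun _ v => c3_1 (gamma v)));
          [intros; now apply Hsm | intros; now apply Hs2 | intros; now rewrite H0 | exact Ht].
      - apply (E (fun u v => c3_2 (Gamma u v)) (fun _ v => c3_2 (gamma v)));
          [intros; now apply Hsm | intros; now apply Hs2 | intros; now rewrite H0 | exact Ht].
      - apply (E (fun u v => c3_3 (Gamma u v)) (fun _ v => c3_3 (gamma v)));
          [intros; now apply Hsm | intros; now apply Hs2 | intros; now rewrite H0 | exact Ht]. }
    evar_last.
    + apply (first_variation a b delta Gamma Hab Hdelta).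
      * intros eps t He Ht. now apply Hsm.
      * intros t Ht. rewrite Hd0 by exact Ht. now apply Hreg.
      * intros eps t He Ht. apply Hsm; [exact He | lra].
      * intros eps He. rewrite !H0 by lra. now apply Hend.
    + rewrite (RInt_ext _ (fun _ => 0)).
      * rewrite RInt_const. apply Rmult_0_r.
      * intros t. rewrite Rmin_left, Rmax_right by lra. intros Ht.
        rewrite (euler_lagrange_ext_loc (Gamma 0) gamma) by now apply Hloc.
        rewrite HEL by lra. unfold Rdiv.
        rewrite Rmult_0_r, Rmult_0_l. apply Ropp_0.
  - intros Hcat.
    set (phi := fun t => (t - a) * (b - t) * euler_lagrange gamma t).
    set (Gamma := normal_variation gamma phi).
    assert (HELs : forall s t, a <= t <= b ->
              smooth_near_2d (fun _ => euler_lagrange gamma) s t)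
      by (intros s t Ht; exact (smooth_near_2d_euler_lagrange _ s t (Hs2 s t Ht))).
    assert (Hsm : forall s t, a <= t <= b -> smooth_near3_2d Gamma s t).
    { intros s t Ht. apply smooth_near3_2d_normal_variation; [now apply Hs2 |].
      specialize (HELs s t Ht). unfold phi. smooth_2d. }
    assert (H0 : forall t, Gamma 0 t = gamma t)
      by (intros t; apply normal_variation_at_zero, Rmult_0_l).
    assert (Hend : forall eps, Gamma eps a = gamma a /\ Gamma eps b = gamma b).
    { intros eps. split; apply normal_variation_at_zero; unfold phi; ring. }
    assert (Hsph' : forall s t, a <= t <= b -> dot3 (Gamma s t) (Gamma s t) = 1)
      by (intros; apply normal_variation_sphere; auto).
    (* An admissible variation stays in the open hemisphere, which fixes the range of eps. *)
    destruct (segment_positivity (fun u v => c3_3 (Gamma u v)) a b 0) as [delta Hd].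
    { intros t Ht. apply smooth_near_2d_continuity, Hsm, Ht. }
    { intros t Ht. rewrite H0. now apply Hz. }
    assert (Hvar : smooth_variation a b gamma delta Gamma).
    { split; [| split].
      - intros eps t He Ht. split; [now apply Hsm |]. split; [now apply Hsph' |].
        apply Hd; [now rewrite Rminus_0_r | exact Ht].
      - intros; apply H0.
      - intros; apply Hend. }
    assert (Hloc : forall t, locally t (fun u => Gamma 0 u = gamma u))
      by (intros t; apply filter_forall, H0).
    assert (HD : forall t, deriv3 (Gamma 0) t = deriv3 gamma t)
      by (intros t; now apply deriv3_ext_loc).
    assert (HI : RInt (fun t => - (dot3 (variation_field Gamma t)
                     (cross3 (Gamma 0 t) (deriv3 (Gamma 0) t))
                   * euler_lagrange (Gamma 0) t / norm3 (deriv3 (Gamma 0) t) ^ 3)) a b = 0).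
    { etransitivity;
        [symmetry | exact (is_derive_unique _ _ _ (Hcat delta Gamma (cond_pos delta) Hvar))].
      apply is_derive_unique.
      apply (first_variation a b delta Gamma Hab (cond_pos delta)).
      - intros; now apply Hsm.
      - intros t Ht. rewrite HD. now apply Hreg.
      - intros; apply Hsph'; lra.
      - intros. rewrite !H0. apply Hend. }
    (* This is minus the integrand of [HI]: <xi, n> = 2 phi |c'|^2, and division by |c'|^3 leaves
       the factor 2 / |c'|. *)
    set (g := fun t => (t - a) * (b - t) * euler_lagrange gamma t ^ 2
                       * (2 / norm3 (deriv3 gamma t))).
    assert (Hnorm : forall t, a <= t <= b -> 0 < norm3 (deriv3 gamma t))
      by (intros; now apply sqrt_lt_R0, Hpos).
    assert (Hgc : forall t, a <= t <= b -> continuous g t).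
    { intros t Ht.
      pose proof (smooth_near3_2d_deriv3 _ _ _ (Hs2 0 t Ht)) as Hd'.
      apply (smooth_near_2d_continuous_2 (fun _ => g) 0).
      apply smooth_near_2d_mult; [specialize (HELs 0 t Ht); smooth_2d |].
      apply smooth_near_2d_div; [now apply Rgt_not_eq, Hnorm | apply smooth_near_2d_const |].
      apply smooth_near_2d_sqrt; [now apply Hpos | now apply smooth_near_2d_dot3]. }
    assert (Hg : RInt g a b = 0).
    { assert (Hopp : RInt (fun t => - g t) a b = - RInt g a b).
      { apply (RInt_opp g), @ex_RInt_continuous. intros t.
        rewrite Rmin_left, Rmax_right by lra. apply Hgc. }
      rewrite (RInt_ext _ (fun t => - g t)) in HI; [lra |].
      intros t. rewrite Rmin_left, Rmax_right by lra. intros Ht.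
      assert (Ht' : a <= t <= b) by lra.
      rewrite H0, HD, (euler_lagrange_ext_loc (Gamma 0) gamma) by apply Hloc.
      unfold Gamma; rewrite normal_variation_field.
      specialize (Hnorm t Ht').
      set (l := norm3 (deriv3 gamma t)) in *.
      set (n := cross3 (gamma t) (deriv3 gamma t)).
      assert (Hnn : dot3 n n = l ^ 2).
      { unfold n, l, norm3. rewrite pow2_sqrt by (apply Rlt_le, Hpos, Ht').
        rewrite dot3_cross3, Hsph, Horth by exact Ht'. ring. }
      unfold g. fold l. f_equal.
      assert (E : forall k p, dot3 (k * c3_1 p, k * c3_2 p, k * c3_3 p) p = k * dot3 p p)
        by (intros k [[? ?] ?]; coords; ring).
      rewrite E, Hnn. unfold phi. field. lra. }
    intros t Ht.
    (* The weight (t - a) (b - t) is positive only in the open interval, so K = 0 is obtained there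
       first. *)
    apply (eq_0_on_closed_interval (euler_lagrange gamma) a b); auto.
    + clear t Ht. intros t Ht.
      assert (Hgt : g t = 0).
      { apply (RInt_nonneg_eq_0 g a b); auto.
        intros u Hu. unfold g. apply Rmult_le_pos; [apply Rmult_le_pos |].
        + apply Rmult_le_pos; lra.
        + apply pow2_ge_0.
        + apply Rlt_le, Rdiv_lt_0_compat; [lra | now apply Hnorm]. }
      assert (H2 : 0 < 2 / norm3 (deriv3 gamma t))
        by (apply Rdiv_lt_0_compat; [lra | apply Hnorm; lra]).
      assert (H3 : 0 < (t - a) * (b - t)) by (apply Rmult_lt_0_compat; lra).
      unfold g in Hgt.
      apply Rmult_integral in Hgt as [Hgt |]; [| lra].
      apply Rmult_integral in Hgt as [| Hgt]; [lra |].
      apply Rsqr_0_uniq. now rewrite Rsqr_pow2.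
    + exact (smooth_near_2d_continuous_2 _ 0 t (HELs 0 t Ht)).
Qed.
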